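(* For every integer $n\ge 0$, the sum over all $P\in\mathbf{B}_n$ of $t^{e(P)}$, where $e(P)$ is the number of down-steps of $P$ that end at an even height (i.e. go from height $2j+1$ to height $2j$ for some $j\ge 0$), equals $$b_n(t) = \sum_{j=0}^{n} \binom{\lfloor n/2 \rfloor}{j} \binom{\lfloor (n+1)/2 \rfloor}{j} t^j.$$
   Context: $\mathbf{B}_n$ denotes the set of all Motzkin paths of length $n$ with no horizontal steps at positive heights: lattice paths from $(0,0)$ to $(n,0)$ that never go below the $x$-axis and consist of $n$ steps, each an up-step $(1,1)$, a down-step $(1,-1)$ or a horizontal step $(1,0)$, where horizontal steps occur only at height $0$. Here $t$ is an indeterminate. *)

(* Defs.v *)
From HB Require Import structures.
From mathcomp Require Import all_boot all_order all_algebra.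

Set Implicit Arguments.
Unset Strict Implicit.
Unset Printing Implicit Defensive.

Import GRing.Theory Num.Theory.
Local Open Scope ring_scope.

Inductive step := Up | Down | Horiz.

Definition step_code (s : step) : option bool :=
  match s with Up => Some true | Down => Some false | Horiz => None end.

Definition step_decode (o : option bool) : step :=
  match o with Some true => Up | Some false => Down | None => Horiz end.

Lemma step_codeK : cancel step_code step_decode.
Proof. by case. Qed.

HB.instance Definition _ := Finite.copy step (can_type step_codeK).

Definition rise (s : step) : int :=
  match s with Up => 1 | Down => -1 | Horiz => 0 end.

(* Ordinate of the point with abscissa k on the path from (0,0) whose
   successive steps are listed in w. *)
Definition height (w : seq step) (k : nat) : int :=
  \sum_(s <- take k w) rise s.

(* The i-th step (counting from 0) goes from height w i to height w i.+1. *)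
Definition Bset (n : nat) : {set n.-tuple step} :=
  [set w : n.-tuple step |
    [&& [forall k : 'I_n.+1, 0 <= height w k],
        height w n == 0 &
        [forall i : 'I_n, (tnth w i == Horiz) ==> (height w i == 0)]]].

Definition even_downs (n : nat) (w : n.-tuple step) : nat :=
  #|[set i : 'I_n | (tnth w i == Down) && (2 %| height w i.+1)%Z]|.

Definition bpoly (n : nat) : {poly int} :=
  \sum_(j < n.+1) ('C(n./2, j) * 'C(n.+1./2, j))%:R *: 'X^j.

(* Main.v *)
Require Import Defs.
From mathcomp Require Import all_boot all_order all_algebra.
From mathcomp Require Import zify.
Import GRing.Theory Num.Theory.
Local Open Scope ring_scope.

(** The proof generalizes the starting height.  Let F(m, h) be the weighted
    count of the m-step paths that start at height h, end at height 0 and obey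
    the same rules ([path_sum] below).  Splitting off the first step gives
      F(m+1, h) = F(m, h+1) + w F(m, h-1)   for h > 0,
      F(m+1, 0) = F(m, 1) + F(m, 0),
    where w is t when h is odd and 1 when h is even.

    A closed form for F is found by unfolding: glue to the half-line of heights
    its mirror image under h |-> -1-h, and let a horizontal step cross the new
    edge between 0 and -1.  Paths become unconstrained walks on the integers
    with steps 1 and -1, ending at 0 or -1 according to parity.  On the mirror
    half the weight sits on up-steps from even to odd positions; a walk that
    starts and ends at or above -1 crosses each edge there equally often in
    both directions, so the weight may be moved to the down-steps from odd to
    even positions.  The weight of a walk is then t^a, with a the number of its
    down-steps taken from odd positions.  Positions alternate in parity, so the
    walk amounts to a free choice of these a steps together with a choice of b
    up-steps among the steps taken from even positions, and the end point fixes
    a - b.  This gives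
      F(m, 2k)   = sum_b C(floor(m/2), b+k)  C(ceil(m/2), b)    t^(b+k),
      F(m, 2k+1) = sum_b C(ceil(m/2), b+k+1) C(floor(m/2), b)   t^(b+k+1).
    Once known, these formulas are checked against the recurrence: each case is
    Pascal's rule in one of the two binomial coefficients ([binsumS_low],
    [binsumS_high]), except that h = 0 also needs the symmetry [binsum0C].
    The case h = 0 is the theorem. *)

(** * Paths from an arbitrary height *)

(** Quantifying over lists of indices, rather than over ordinals bounded by the
    length, lets the first step be peeled off by computation. *)
Definition motzkin_from (h : int) (w : seq step) : bool :=
  [&& all (fun k => 0 <= h + height w k) (iota 0 (size w).+1),
      h + height w (size w) == 0 &
      all (fun i => (nth Up w i == Horiz) ==> (h + height w i == 0))
          (iota 0 (size w))].

Definition even_downs_from (h : int) (w : seq step) : nat :=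
  \sum_(i < size w) ((nth Up w i == Down) && (2 %| (h + height w i.+1)%R)%Z).

Definition path_sum (m : nat) (h : int) : {poly int} :=
  \sum_(w : m.-tuple step | motzkin_from h w) 'X^(even_downs_from h w).

Lemma height0 (w : seq step) : height w 0 = 0.
Proof. by rewrite /height take0 big_nil. Qed.

Lemma height_cons (s : step) (w : seq step) (k : nat) :
  height (s :: w) k.+1 = rise s + height w k.
Proof. by rewrite /height /= big_cons. Qed.

Lemma motzkin_from_cons (h : int) (s : step) (w : seq step) :
  motzkin_from h (s :: w) =
  [&& 0 <= h, (s == Horiz) ==> (h == 0) & motzkin_from (h + rise s) w].
Proof.
have all_iotaS (p : pred nat) n :
    all p (iota 0 n.+1) = p 0%N && all (fun k => p k.+1) (iota 0 n).
  by rewrite /= -[1%N]addn0 iotaDl all_map.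
rewrite /motzkin_from [size (s :: w)]/= height_cons addrA.
rewrite (all_iotaS _ (size w).+1) (all_iotaS (fun i => _ ==> _)).
rewrite !height0 !addr0.
rewrite (eq_all (a1 := fun k => 0 <= h + height (s :: w) k.+1)
  (a2 := fun k => 0 <= h + rise s + height w k)); last first.
  by move=> k; rewrite height_cons addrA.
rewrite (eq_all (a1 := fun k => (nth Up (s :: w) k.+1 == _) ==> _)
  (a2 := fun i => (nth Up w i == Horiz) ==> (h + rise s + height w i == 0)));
  last by move=> k; rewrite height_cons addrA.
by rewrite -!andbA; do !bool_congr.
Qed.

Lemma even_downs_from_cons (h : int) (s : step) (w : seq step) :
  even_downs_from h (s :: w) =
  (((s == Down) && (2 %| (h + rise s)%R)%Z) + even_downs_from (h + rise s) w)%N.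
Proof.
rewrite /even_downs_from big_ord_recl /= height_cons height0 addr0.
congr (_ + _)%N; apply: eq_bigr => i _.
by rewrite /= height_cons addrA.
Qed.

Lemma Bset_motzkin_from (n : nat) (w : n.-tuple step) :
  (w \in Bset n) = motzkin_from 0 w.
Proof.
rewrite inE /motzkin_from size_tuple add0r.
congr [&& _, _ & _].
- apply/forallP/allP => [H k | H k].
    by rewrite mem_iota add0n => /andP[_ lt_k]; rewrite add0r (H (Ordinal lt_k)).
  by have := H k; rewrite mem_iota add0r; apply; case: k.
- apply/forallP/allP => [H k | H k].
    rewrite mem_iota add0n => /andP[_ lt_k].
    by have := H (Ordinal lt_k); rewrite add0r (tnth_nth Up).
  by have := H k; rewrite mem_iota add0r (tnth_nth Up); apply; case: k.
Qed.

Lemma even_downs_fromE (n : nat) (w : n.-tuple step) :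
  even_downs w = even_downs_from 0 w.
Proof.
rewrite /even_downs /even_downs_from size_tuple -sum1_card.
rewrite big_mkcond; apply: eq_bigr => i _.
by rewrite inE (tnth_nth Up) add0r; case: ifP.
Qed.

(** * The first-step recurrence *)

Lemma sum_tuple_cons (V : nmodType) (T : finType) (n : nat)
    (P : pred (seq T)) (f : seq T -> V) :
  \sum_(w : n.+1.-tuple T | P w) f w =
  \sum_(x : T) \sum_(w : n.-tuple T | P (x :: w)) f (x :: w).
Proof.
rewrite pair_big_dep /=.
rewrite (reindex (fun p : T * n.-tuple T => cons_tuple p.1 p.2)) //=.
exists (fun w : n.+1.-tuple T => (thead w, behead_tuple w)) => [[x w] _ | w _] /=.
  by congr (_, _); apply: val_inj.
by case/tupleP: w => x w; apply: val_inj.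
Qed.

Lemma sum_step (V : nmodType) (f : step -> V) :
  \sum_(s : step) f s = f Up + f Down + f Horiz.
Proof.
rewrite (bigD1 Up) //= (bigD1 Down) //= (bigD1 Horiz) //= big1 ?addr0 ?addrA //.
by case.
Qed.

Lemma path_sumS (m : nat) (h : int) : 0 <= h ->
  path_sum m.+1 h = path_sum m (h + 1)
    + 'X^((2 %| (h - 1)%R)%Z) * path_sum m (h - 1) + path_sum m h *+ (h == 0).
Proof.
move=> h_ge0; rewrite /path_sum.
rewrite (sum_tuple_cons _ _ _ (motzkin_from h)
  (fun w => 'X^(even_downs_from h w) : {poly int})) sum_step.
congr (_ + _ + _).
- by apply: eq_big => w; rewrite ?motzkin_from_cons ?even_downs_from_cons h_ge0.
- rewrite big_distrr; apply: eq_big => w; first by rewrite motzkin_from_cons h_ge0.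
  by rewrite even_downs_from_cons exprD.
- have [-> | h_neq0] := eqVneq h 0.
    rewrite mulr1n.
    by apply: eq_big => w; rewrite ?motzkin_from_cons ?even_downs_from_cons.
  by rewrite big_pred0 // => w; rewrite motzkin_from_cons (negPf h_neq0) h_ge0.
Qed.

Lemma motzkin_from_ge0 (h : int) (w : seq step) : motzkin_from h w -> 0 <= h.
Proof. by case/and3P => /=; rewrite height0 addr0 => /andP[]. Qed.

Lemma path_sum_neg (m : nat) (h : int) : h < 0 -> path_sum m h = 0.
Proof.
move=> h_lt0; rewrite /path_sum big_pred0 // => w.
by apply/negbTE/negP => /motzkin_from_ge0; lia.
Qed.

Lemma path_sum0 (h : nat) : path_sum 0 h%:Z = (h == 0%N)%:R.
Proof.
rewrite /path_sum (eq_bigr (fun=> 1)) => [|w _]; last first.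
  by rewrite tuple0 /even_downs_from big_ord0.
have P w : motzkin_from h%:Z (w : 0.-tuple step) = (h == 0%N).
  by rewrite tuple0 /motzkin_from /= height0 addr0 !andbT.
rewrite (eq_bigl _ _ P); case: (h == 0%N); last by rewrite big_pred0.
by rewrite sumr_const card_tuple expn0.
Qed.

(** * The closed form *)

(** The walks of the unfolded picture: [p] steps are available at odd positions,
    [q] at even ones, and [k] is the prescribed excess of down-steps from odd
    positions over up-steps from even positions.  Indexing by the smaller
    number [b] avoids truncated subtraction. *)
Definition binsum (k p q : nat) : {poly int} :=
  \sum_(b < q.+1) ('C(p, b + k) * 'C(q, b))%:R *: 'X^(b + k).

Lemma binsum_widen (N k p q : nat) : (q < N)%N ->
  binsum k p q = \sum_(b < N) ('C(p, b + k) * 'C(q, b))%:R *: 'X^(b + k).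
Proof.
move=> lt_qN; rewrite /binsum.
rewrite (big_ord_widen N (fun b => ('C(p, b + k) * 'C(q, b))%:R *: 'X^(b + k))) //.
rewrite big_mkcond; apply: eq_bigr => b _; case: ltnP => // lt_qb.
by rewrite (bin_small lt_qb) muln0 scale0r.
Qed.

Lemma binsumS_low (k p q : nat) :
  binsum k p q.+1 = binsum k p q + binsum k.+1 p q.
Proof.
rewrite (binsum_widen q.+2 k p q) // /binsum big_ord_recl.
rewrite [in RHS]big_ord_recl !bin0 -addrA; congr (_ + _).
rewrite -big_split /=; apply: eq_bigr => b _.
by rewrite /bump /= add1n binS mulnDr natrD scalerDl addSnnS.
Qed.

Lemma binsumS_high (k p q : nat) :
  binsum k.+1 p.+1 q = binsum k.+1 p q + 'X * binsum k p q.
Proof.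
rewrite /binsum big_distrr -big_split /=; apply: eq_bigr => b _.
by rewrite addnS binS mulnDl natrD scalerDl -scalerAr -exprS.
Qed.

Lemma binsum0C (p q : nat) : binsum 0 p q = binsum 0 q p.
Proof.
rewrite (binsum_widen (p + q).+1 _ p q) ?(binsum_widen (p + q).+1 _ q p); try lia.
by apply: eq_bigr => b _; rewrite !addn0 mulnC.
Qed.

Lemma binsum00 (k : nat) : binsum k 0 0 = (k == 0%N)%:R.
Proof.
rewrite /binsum big_ord1 bin0 muln1 add0n.
by case: k => [|k]; rewrite ?scale1r ?bin0n ?scale0r.
Qed.

(** The two parities of the height must be treated together, since the
    recurrence exchanges them. *)
Lemma path_sumE (m k : nat) :
  path_sum m (k.*2)%:Z = binsum k m./2 m.+1./2 /\
  path_sum m (k.*2.+1)%:Z = binsum k.+1 m.+1./2 m./2.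
Proof.
elim: m k => [|m IHm] k.
  by rewrite !path_sum0 !binsum00 double_eq0.
have half_SS : m.+2./2 = m./2.+1 by [].
split; rewrite half_SS path_sumS //.
- case: k => [|k].
    (* The bottom case: the horizontal step contributes F(m, 0), whose two
       binomials appear in the opposite order. *)
    rewrite (path_sum_neg _ (_ - 1)) // mulr0 addr0 eqxx mulr1n.
    have [-> _] := IHm 0%N; have [_ ->] := IHm 0%N.
    by rewrite binsumS_low [in RHS]binsum0C addrC.
  have -> : (k.+1.*2)%:Z + 1 = (k.+1.*2.+1)%:Z by lia.
  have -> : (k.+1.*2)%:Z - 1 = (k.*2.+1)%:Z by lia.
  have -> : ((k.+1.*2)%:Z == 0) = false by lia.
  have -> : (2 %| (k.*2.+1)%:Z)%Z = false by lia.
  have [_ ->] := IHm k.+1; have [_ ->] := IHm k.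
  by rewrite mul1r addr0 binsumS_low addrC.
- have -> : (k.*2.+1)%:Z + 1 = (k.+1.*2)%:Z by lia.
  have -> : (k.*2.+1)%:Z - 1 = (k.*2)%:Z by lia.
  have -> : ((k.*2.+1)%:Z == 0) = false by lia.
  have -> : (2 %| (k.*2)%:Z)%Z by lia.
  have [-> _] := IHm k.+1; have [-> _] := IHm k.
  by rewrite expr1 addr0 binsumS_high.
Qed.

Theorem mainTheorem5 (n : nat) :
  \sum_(P in Bset n) 'X^(even_downs P) = bpoly n.
Proof.
transitivity (path_sum n 0).
  apply: eq_big => w; first exact: Bset_motzkin_from.
  by rewrite even_downs_fromE.
have [-> _] := path_sumE n 0.
rewrite (binsum_widen n.+1); last lia.
by apply: eq_bigr => b _; rewrite addn0.
Qed.
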